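(* For every integer $k\geq 1$ there is a prime $p\equiv 3\pmod 4$ such that for all $n\geq 1$ and for all vectors $\mathbf{v},\mathbf{w}\in\mathbb{F}_{p^2}^n$ of Manhattan norm at most $k$, $$(\mathbf{v}\cdot\mathbf{w})(\mathbf{w}\cdot\mathbf{v})\leq_p(\mathbf{v}\cdot\mathbf{v})(\mathbf{w}\cdot\mathbf{w}).$$
   Context: For a prime $p\equiv 3\pmod 4$, the field $\mathbb{F}_{p^2}$ is regarded as $\mathbb{Z}[i]/(p)$, with prime subfield $\mathbb{F}_p$. Manhattan norm: $\mathbb{F}_{p^2}$ is a graph in which two distinct vertices $u,z$ are adjacent if $(z-u)^4=1$ (equivalently $z-u\in\{1,-1,i,-i\}$). For $z\in\mathbb{F}_{p^2}$, $N(z)$ is the graph distance from $0$ to $z$ in this graph. The vector space $\mathbb{F}_{p^2}^n$ carries the Cartesian product graph structure, and the Manhattan norm of $\mathbf{v}=(v_1,\ldots,v_n)\in\mathbb{F}_{p^2}^n$ is its distance from the null vector, which equals $N(\mathbf{v})=N(v_1)+\cdots+N(v_n)$. Inner product: for $z\in\mathbb{F}_{p^2}$, $\overline{z}$ is the image of $z$ under the only non-trivial automorphism of $\mathbb{F}_{p^2}$. For $\mathbf{v}=(v_1,\ldots,v_n)$ and $\mathbf{w}=(w_1,\ldots,w_n)$ in $\mathbb{F}_{p^2}^n$, $\mathbf{v}\cdot\mathbf{w}=v_1\overline{w_1}+\cdots+v_n\overline{w_n}\in\mathbb{F}_{p^2}$. Both $(\mathbf{v}\cdot\mathbf{w})(\mathbf{w}\cdot\mathbf{v})$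 and $(\mathbf{v}\cdot\mathbf{v})(\mathbf{w}\cdot\mathbf{w})$ belong to $\mathbb{F}_p$. Relation $\leq_p$ on $\mathbb{F}_p$: $x<_p y$ means that $y-x$ is a non-zero square in $\mathbb{F}_p$, and $x\leq_p y$ means $x<_p y$ or $x=y$. (This relation is not transitive.) *)

(* Defs.v *)
From HB Require Import structures.
From mathcomp Require Import all_boot all_order all_algebra all_field.
Set Implicit Arguments.
Unset Strict Implicit.
Unset Printing Implicit Defensive.
Import Order.TTheory GRing.Theory Num.Theory.
Local Open Scope ring_scope.

Definition walk_of_length (T : finType) (e : rel T) (x y : T) (m : nat) : bool :=
  [exists t : m.-tuple T, path e x t && (last x t == y)].

(* A shortest walk has fewer than #|T| edges, so restricting the search to
   lengths below #|T| loses nothing; the value is #|T| when y cannot be reached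
   from x, which does not occur in the graphs below when F has p ^ 2 elements
   with p a prime, p = 3 mod 4. *)
Definition graph_dist (T : finType) (e : rel T) (x y : T) : nat :=
  find (walk_of_length e x y) (iota 0 #|T|).

Definition adj (F : finFieldType) : rel F :=
  fun u z => (u != z) && ((z - u) ^+ 4 == 1).

Definition cartesian_adj (F : finFieldType) (n : nat) : rel 'rV[F]_n :=
  fun u v => [exists j : 'I_n, adj (u 0 j) (v 0 j) &&
                [forall l : 'I_n, (l != j) ==> (u 0 l == v 0 l)]].

Definition manhattan_norm (F : finFieldType) (n : nat) (v : 'rV[F]_n) : nat :=
  graph_dist (@cartesian_adj F n) 0 v.

(* In a field with p ^ 2 elements, p prime, exactly one morphism satisfies this. *)
Definition nontrivial_automorphism (F : finFieldType) (f : {rmorphism F -> F}) :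
    Prop :=
  bijective f /\ exists z : F, f z <> z.

Definition inner (F : finFieldType) (conj : {rmorphism F -> F}) (n : nat)
    (v w : 'rV[F]_n) : F :=
  \sum_(j < n) v 0 j * conj (w 0 j).

Definition ltFp (p : nat) (x y : 'F_p) : Prop :=
  exists s : 'F_p, y - x <> 0 /\ y - x = s ^+ 2.

Definition leFp (p : nat) (x y : 'F_p) : Prop := ltFp x y \/ x = y.

(* The embedding of the prime field into a field of characteristic p. *)
Definition of_Fp (p : nat) (F : finFieldType) (x : 'F_p) : F := (x : nat)%:R.

(* The relation on 'F_p, transported to the prime subfield of F; in particular
   a and b are required to lie in that subfield. *)
Definition le_prime_subfield (p : nat) (F : finFieldType) (a b : F) : Prop :=
  exists x y : 'F_p, [/\ of_Fp F x = a, of_Fp F y = b & leFp x y].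

(* Main.v *)
Require Import Defs.
From HB Require Import structures.
From mathcomp Require Import all_boot all_order all_algebra all_field.
From mathcomp Require Import all_fingroup all_solvable.
From mathcomp Require Import complex realalg polyrcf.
From mathcomp Require Import ring lra zify.
Set Implicit Arguments.
Unset Strict Implicit.
Unset Printing Implicit Defensive.
Import Order.TTheory GRing.Theory Num.Theory.
Local Open Scope ring_scope.

(** Vectors of Manhattan norm at most k lift to vectors of Gaussian integers of
    l1-norm at most k (manhattan_lift). For the lifts, the Cauchy-Schwarz
    inequality cauchy_schwarz_int says that the difference of the two sides is an
    integer D with 0 <= D <= k^4. It is therefore enough to find a prime p > k,
    p = 3 modulo 4, modulo which every integer from 1 to M = k^4 is a square
    (prime_small_squares); the statement then follows for all n at once.

    Such a p is any prime congruent to -1 modulo m = 8 M!. Indeed, if y is a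
    primitive m-th root of unity in characteristic p, then Frobenius maps y to
    1/y, and every D <= M has a square root, given by an explicit expression in
    powers of y, that is invariant under this substitution (fixed_sqrt). The
    square root then lies in the prime field. This replaces quadratic
    reciprocity.

    Primes congruent to -1 modulo m are found without Dirichlet's theorem. Being
    palindromic, the cyclotomic polynomial satisfies
    'Phi_m = X^d Psi(X + 1/X), where the integral monic polynomial Psi has the
    simple real root 2 cos (2 pi / m) and so takes negative values on an open
    interval (real_cyclotomic_negative). A fraction a / b in this interval, with
    a = 1 modulo m and b a power of m, gives a positive integer - b^d Psi(a / b)
    congruent to -1 modulo m. It has a prime factor p = 3 modulo 4
    (exists_prime_root), and Psi has a root modulo p. This root is y + 1/y with
    y a primitive m-th root of unity, so Frobenius sends y to y or to 1/y;
    since 4 divides m, the condition p = 3 modulo 4 leaves only 1/y. *)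

(** * Palindromic polynomials as polynomials in X + 1/X *)

(** This is the polynomial X^d P(X + 1/X), written without denominators: the
    term of index i is P_i X^(d-i) (X^2+1)^i. *)
Definition palindromic_of (R : comNzRingType) (d : nat) (P : {poly R}) : {poly R} :=
  \sum_(i < d.+1) P`_i *: ('X^(d - i) * ('X^2 + 1) ^+ i).

Section PalindromicOf.
Variable R : comNzRingType.
Implicit Types P Q : {poly R}.

Lemma palindromic_ofD d P Q : palindromic_of d (P + Q) = palindromic_of d P + palindromic_of d Q.
Proof. by rewrite -big_split /=; apply: eq_bigr => i _; rewrite coefD scalerDl. Qed.

Lemma palindromic_ofZ d c P : palindromic_of d (c *: P) = c *: palindromic_of d P.
Proof. by rewrite scaler_sumr; apply: eq_bigr => i _; rewrite coefZ scalerA. Qed.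

Lemma palindromic_ofX d P : palindromic_of d.+1 ('X * P) = ('X^2 + 1) * palindromic_of d P.
Proof.
rewrite /palindromic_of big_ord_recl coefXM /= scale0r add0r mulr_sumr.
apply: eq_bigr => i _; rewrite coefXM /= /bump /= add1n subSS exprS -scalerAr.
by congr (_ *: _); rewrite mulrCA.
Qed.

Lemma palindromic_of_widen d P : (size P <= d.+1)%N ->
  palindromic_of d.+1 P = 'X * palindromic_of d P.
Proof.
move=> sP; rewrite /palindromic_of big_ord_recr /= nth_default // scale0r addr0 mulr_sumr.
apply: eq_bigr => i _; rewrite subSn -1?ltnS // exprS -scalerAr mulrA.
by [].
Qed.

(** Multiplicativity against a linear factor: a double root r of P thus becomes
    a double factor X^2 + 1 - r X of the palindromic polynomial. *)
Lemma palindromic_ofM_XsubC d c P : (size P <= d.+1)%N ->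
  palindromic_of d.+1 (('X - c%:P) * P) = ('X^2 + 1 - c *: 'X) * palindromic_of d P.
Proof.
move=> sP; rewrite mulrBl mul_polyC palindromic_ofD -scaleNr palindromic_ofZ.
rewrite palindromic_ofX palindromic_of_widen //.
by rewrite mulrBl scaleNr scalerAl.
Qed.

Lemma palindromic_ofXn d : palindromic_of d 'X^d = ('X^2 + 1) ^+ d :> {poly R}.
Proof.
rewrite /palindromic_of big_ord_recr /= big1 => [|i _].
  by rewrite add0r coefXn eqxx scale1r subnn expr0 mul1r.
by rewrite coefXn ltn_eqF ?scale0r.
Qed.

Lemma coef_X2D1_sym d k : (k <= d.*2)%N ->
  (('X^2 + 1) ^+ d : {poly R})`_k = (('X^2 + 1) ^+ d)`_(d.*2 - k).
Proof.
move=> le_k; rewrite exprD1n !coef_sum (reindex_inj rev_ord_inj) /=.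
apply: eq_bigr => i _; rewrite -!exprM !coefMn !coefXn subSS bin_sub -1?ltnS //.
congr ((nat_of_bool _)%:R *+ _); have := ltn_ord i.
by lia.
Qed.

Lemma size_X2D1 d : (size (('X^2 + 1) ^+ d : {poly R}) <= d.*2.+1)%N.
Proof.
apply: leq_trans (size_poly_exp_leq _ _) _.
by rewrite -[1]/(1%:P) size_XnaddC // mulnC -addnn; lia.
Qed.

(** Subtracting c (X^2+1)^d, where c is the leading (hence also the constant)
    coefficient, leaves X times a palindromic polynomial of formal degree
    2(d-1). *)
Lemma palindromic_ofP d P : (size P <= d.*2.+1)%N ->
    (forall i, (i <= d.*2)%N -> P`_i = P`_(d.*2 - i)) ->
  exists Q, [/\ (size Q <= d.+1)%N, Q`_d = P`_d.*2 & P = palindromic_of d Q].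
Proof.
elim: d P => [|d IHd] P sP symP.
  exists P; split=> //; rewrite /palindromic_of big_ord1 /= !expr0 mulr1.
  by rewrite [LHS](size1_polyC sP) alg_polyC.
pose c := P`_d.+1.*2; pose P1 := P - c *: ('X^2 + 1) ^+ d.+1.
have symP1 i : (i <= d.+1.*2)%N -> P1`_i = P1`_(d.+1.*2 - i).
  by move=> le_i; rewrite !coefB !coefZ symP // coef_X2D1_sym.
have P10 : P1`_0 = 0.
  rewrite coefB coefZ symP // subn0 -/c -horner_coef0 !hornerE.
  by rewrite expr0n add0r expr1n mulr1 subrr.
have sP1 : (size P1 <= d.+1.*2)%N.
  apply/leq_sizeP => j; rewrite leq_eqVlt => /predU1P[<-|lt_j].
    by rewrite symP1 // subnn.
  rewrite coefB coefZ !nth_default ?mulr0 ?subr0 //.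
    by apply: leq_trans (size_X2D1 _) _.
  exact: leq_trans lt_j.
pose P2 := drop_poly 1 P1.
have P2E i : P2`_i = P1`_i.+1 by rewrite coef_drop_poly addn1.
have P1E : P1 = 'X * P2.
  by apply/polyP => -[|i]; rewrite coefXM //= P2E.
have [||Q [sQ _ P2h]] := IHd P2.
- by rewrite size_drop_poly; move: sP1; lia.
- move=> i le_i; rewrite !P2E symP1 ?doubleS; last by lia.
  by congr (P1`_ _); lia.
exists (Q + c *: 'X^(d.+1)); split.
- rewrite (leq_trans (size_polyD _ _)) // geq_max (leq_trans sQ) //=.
  by rewrite (leq_trans (size_scale_leq _ _)) // size_polyXn.
- by rewrite coefD coefZ coefXn eqxx mulr1 nth_default // add0r.
- rewrite palindromic_ofD palindromic_ofZ palindromic_ofXn palindromic_of_widen //.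
  by rewrite -P2h -P1E subrK.
Qed.

End PalindromicOf.

Lemma map_palindromic_of (R S : comNzRingType) (f : {rmorphism R -> S}) d P :
  map_poly f (palindromic_of d P) = palindromic_of d (map_poly f P).
Proof.
rewrite rmorph_sum; apply: eq_bigr => i _ /=.
by rewrite map_polyZ rmorphM /= coef_map map_polyXn rmorphXn rmorphD /= map_polyXn rmorph1.
Qed.

Lemma horner_palindromic_of (F : fieldType) d (P : {poly F}) y : y != 0 ->
  (size P <= d.+1)%N -> (palindromic_of d P).[y] = y ^+ d * P.[y + y^-1].
Proof.
move=> y0 sP; rewrite (horner_coef_wide _ sP) mulr_sumr /palindromic_of horner_sum.
apply: eq_bigr => i _; rewrite hornerZ hornerM !horner_exp.
rewrite hornerD horner_exp !hornerX hornerC [RHS]mulrCA; congr (_ * _).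
have -> : y ^+ 2 + 1 = y * (y + y^-1) by rewrite mulrDr divff.
by rewrite exprMn mulrA -exprD subnK // -ltnS.
Qed.

(** * Cyclotomic polynomials and their real subfield *)

(** If y were a root of 'Phi_m of smaller
    order d, it would also be a root of some 'Phi_c with c dividing d, hence a
    double root of the separable polynomial X^m - 1. *)
Lemma root_Cyclotomic (F : fieldType) m (y : F) : m%:R != 0 :> F ->
  root (map_poly intr 'Phi_m) y = m.-primitive_root y.
Proof.
move=> m0; have m_gt0 : (0 < m)%N by case: m m0; rewrite ?eqxx.
pose f e : {poly F} := map_poly intr 'Phi_e.
have prodf e : (e > 0)%N -> \prod_(c <- divisors e) f c = 'X^e - 1.
  move=> e0; rewrite -rmorph_prod prod_Cyclotomic //=.
  by rewrite rmorphB /= map_polyXn rmorph1.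
have rootf e : (e > 0)%N -> y ^+ e = 1 -> exists2 c, (c %| e)%N & root (f c) y.
  move=> e0 ye; have: root ('X^e - 1) y by rewrite rootE !hornerE ye subrr.
  rewrite -prodf // rootE horner_prod prodf_seq_eq0 => /hasP[c] /=.
  by rewrite -dvdn_divisors // => ? ?; exists c.
have froot c e : (e > 0)%N -> (c %| e)%N -> root (f c) y -> y ^+ e = 1.
  move=> e0 ce /rootP fc0; have: root ('X^e - 1) y.
    rewrite -prodf // rootE horner_prod prodf_seq_eq0; apply/hasP; exists c => /=.
      by rewrite -dvdn_divisors.
    exact/eqP.
  by rewrite rootE !hornerE subr_eq0 => /eqP.
apply/idP/idP => [fm|prim_y].
  have ym := froot m m m_gt0 (dvdnn m) fm.
  have [d prim_d dm] := prim_order_exists m_gt0 ym.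
  have [->//|ne_dm] := eqVneq m d.
  have d_gt0 := prim_order_gt0 prim_d.
  have [c cd fc] := rootf d d_gt0 (prim_expr_order prim_d).
  have ne_cm : c != m.
    by apply: contraNneq ne_dm => cm; rewrite eqn_dvd dm -cm cd.
  have := separable_Xn_sub_1 m0; rewrite -prodf //.
  rewrite (big_rem m) /= -?dvdn_divisors // (big_rem c) /=; last first.
    by rewrite mem_rem_uniq ?divisors_uniq // inE ne_cm -dvdn_divisors ?(dvdn_trans cd).
  rewrite mulrA !separable_mul => /andP[/and3P[_ _ cop] _].
  by have := coprimep_root cop fm; rewrite (rootP fc) eqxx.
have [c cm fc] := rootf m m_gt0 (prim_expr_order prim_y).
have c_gt0 := dvdn_gt0 m_gt0 cm.
have := froot c c c_gt0 (dvdnn c) fc => /eqP; rewrite -(prim_order_dvd prim_y) => mc.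
have -> // : m = c by apply/eqP; rewrite eqn_dvd cm mc.
Qed.

Lemma prim_rootV (F : fieldType) m (z : F) :
  m.-primitive_root z -> m.-primitive_root z^-1.
Proof.
move=> prim_z; have m_gt0 := prim_order_gt0 prim_z.
have z0 : z != 0 by rewrite (prim_root_eq0 prim_z) -lt0n.
have -> : z^-1 = z ^+ m.-1.
  by apply: (mulfI z0); rewrite divff // -exprS prednK // prim_expr_order.
by rewrite prim_root_exp_coprime // coprimePn.
Qed.

(** The primitive roots are stable under inversion, so the reversed polynomial Q
    is a constant multiple of P = 'Phi_m. Evaluation at 1, which is not a
    root, shows that the constant is 1; evaluation at -1 then shows that the
    degree is even. *)
Lemma Cyclotomic_palindromic m : (2 < m)%N ->
  ~~ odd (totient m) /\ forall i, (i <= totient m)%N -> 'Phi_m`_i = 'Phi_m`_(totient m - i).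
Proof.
move=> m_gt2; have m_gt0 : (0 < m)%N by lia.
set n := totient m.
pose P : {poly algC} := map_poly intr 'Phi_m.
have m0 : m%:R != 0 :> algC by rewrite pnatr_eq0; lia.
have rootP y : root P y = m.-primitive_root y := root_Cyclotomic y m0.
have sP : size P = n.+1.
  by rewrite size_map_poly_id0 ?size_Cyclotomic // (monicP (Cyclotomic_monic m)) rmorph1 oner_eq0.
pose Q := \poly_(i < n.+1) P`_(n - i).
have QE y : y != 0 -> Q.[y] = y ^+ n * P.[y^-1].
  move=> y0; rewrite horner_poly horner_coef sP mulr_sumr (reindex_inj rev_ord_inj).
  apply: eq_bigr => i _ /=; have le_in : (i <= n)%N by rewrite -ltnS.
  rewrite subSS subKn // [RHS]mulrCA; congr (_ * _).
  have -> : y ^+ n = y ^+ (n - i) * y ^+ i by rewrite -exprD subnK.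
  by rewrite -mulrA -exprMn divff // expr1n mulr1.
have nroot y : y ^+ 2 = 1 -> P.[y] != 0.
  move=> y2; apply/negP; rewrite -[_ == 0]/(root P y) rootP => prim.
  have := prim_order_dvd prim 2; rewrite y2 eqxx => /dvdn_leq; lia.
have [z prim_z] := C_prim_root_exists m_gt0.
have PE : P = cyclotomic z m by apply: Cintr_Cyclotomic.
have : P %| Q.
  rewrite PE /cyclotomic -big_filter -(big_map (fun k : 'I_m => z ^+ k) xpredT (fun x => 'X - x%:P)).
  apply: uniq_roots_dvdp.
    apply/allP => x /mapP[k]; rewrite mem_filter => /andP[cop _] ->{x}.
    have prim_k : m.-primitive_root (z ^+ k) by rewrite prim_root_exp_coprime.
    have zk0 : z ^+ k != 0 by rewrite (prim_root_eq0 prim_k); lia.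
    rewrite rootE QE // mulf_eq0 -[P.[_] == 0]/(root P _) rootP.
    by rewrite prim_rootV // orbT.
  rewrite uniq_rootsE map_inj_in_uniq ?filter_uniq ?index_enum_uniq //.
  move=> i j _ _ /eqP; rewrite (eq_prim_root_expr prim_z) !modn_small // => /eqP.
  exact: val_inj.
move=> /dvdpP[q Qq].
have Q1 : Q.[1] = P.[1] by rewrite QE ?oner_eq0 // expr1n mul1r invr1.
have P1 := nroot 1 (expr1n _ _).
have sq : (size q <= 1)%N.
  have q0 : q != 0 by apply: contraNneq P1 => q0; rewrite -Q1 Qq q0 mul0r horner0.
  have P0 : P != 0 by rewrite -size_poly_eq0 sP.
  by have := size_poly n.+1 (fun i => P`_(n - i));
  rewrite -/Q Qq size_mul // sP addnS -(add1n n) leq_add2r.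
have QP : Q = P.
  move: Q1; rewrite Qq [q](size1_polyC sq) hornerM hornerC => /(canRL (mulfK P1)).
  by rewrite divff // => ->; rewrite mul1r.
split=> [|i le_i].
  have N1 : (-1 : algC) != 0 by rewrite oppr_eq0 oner_eq0.
  have := QE _ N1; rewrite QP invrN1 => /eqP; rewrite -subr_eq0 -{1}[P.[_]]mul1r -mulrBl.
  rewrite mulf_eq0 (negPf (nroot (-1) _)) ?sqrrN ?expr1n // orbF -signr_odd.
  by case: odd => //; rewrite expr1 opprK -[_ + _]/(2%:R) pnatr_eq0.
apply: (@intr_inj algC); rewrite -!coef_map /= -/P -{1}QP coef_poly.
by rewrite ltnS le_i.
Qed.

(** Psi is the minimal polynomial of 2 cos (2 pi / m). *)
Lemma Cyclotomic_palindromic_of m : (2 < m)%N ->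
  exists d (Psi : {poly int}),
    [/\ (size Psi <= d.+1)%N, Psi`_d = 1 & 'Phi_m = palindromic_of d Psi].
Proof.
move=> m_gt2; have [evn sym] := Cyclotomic_palindromic m_gt2.
have tE : totient m = (totient m)./2.*2 by rewrite -[LHS]odd_double_half (negPf evn).
have [||Psi [sPsi PsiE ->]] := @palindromic_ofP _ (totient m)./2 'Phi_m.
- by rewrite size_Cyclotomic -tE.
- by move=> i; rewrite -tE; apply: sym.
exists (totient m)./2, Psi; split=> //.
rewrite PsiE -tE; have := monicP (Cyclotomic_monic m).
by rewrite lead_coefE size_Cyclotomic.
Qed.

Lemma closed_prim_root (C : closedFieldType) n :
  n%:R != 0 :> C -> exists z : C, n.-primitive_root z.
Proof.
move=> n0; have n_gt0 : (0 < n)%N by case: n n0; rewrite ?eqxx.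
pose p : {poly C} := 'X^n - 1; have [r Dp] := closed_field_poly_normal p.
move: Dp; rewrite (monicP _) ?monicXnsubC ?scale1r // => Dp.
have sz_r : (n <= size r)%N by rewrite -ltnS -(size_prod_XsubC r id) -Dp size_XnsubC.
have rn1 : all n.-unity_root r by apply/allP=> x; rewrite -root_prod_XsubC -Dp.
have /hasP[z _ prim] : has n.-primitive_root r.
  by rewrite has_prim_root // -separable_prod_XsubC -Dp separable_Xn_sub_1.
by exists z.
Qed.

Lemma separable_Cyclotomic (F : fieldType) m : m%:R != 0 :> F ->
  separable_poly (map_poly intr 'Phi_m : {poly F}).
Proof.
move=> m0; have m_gt0 : (0 < m)%N by case: m m0; rewrite ?eqxx.
have := separable_Xn_sub_1 m0.
have -> : 'X^m - 1 = \prod_(c <- divisors m) map_poly intr 'Phi_c :> {poly F}.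
  by rewrite -rmorph_prod prod_Cyclotomic //= rmorphB /= map_polyXn rmorph1.
rewrite (big_rem m) /= -?dvdn_divisors // separable_mul.
by case/and3P.
Qed.

(** The norm of z is a positive real number whose m-th power is 1, hence z^-1 is
    the conjugate of z. *)
Lemma complex_prim_root_real (R : rcfType) m (z : R[i]) : m.-primitive_root z ->
  exists r : R, z + z^-1 = r%:C%C.
Proof.
move=> prim_z; have m_gt0 := prim_order_gt0 prim_z.
have z0 : z != 0 by rewrite (prim_root_eq0 prim_z) -lt0n.
have wE : z * conjc z = ((complex.Re z) ^+ 2 + (complex.Im z) ^+ 2)%:C%C.
  by case: (z) => a b /=; simpc; congr (_ +i* _)%C; ring.
set w := (X in X%:C%C) in wE.
have : (w%:C%C) ^+ m = 1 :> R[i].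
  by rewrite -wE exprMn -rmorphXn /= (prim_expr_order prim_z) rmorph1 mul1r.
rewrite -rmorphXn -(rmorph1 (real_complex R)) => /(@complexI R)/eqP.
rewrite pexpr_eq1 // ?addr_ge0 ?sqr_ge0 // => /eqP w1.
exists (complex.Re z + complex.Re z).
have -> : z^-1 = conjc z by apply: (mulfI z0); rewrite divff // wE w1.
by case: (z) => a b /=; simpc.
Qed.

(** A polynomial changes sign at a simple root, so it is negative on one side. *)
Lemma simple_root_sign (R : rcfType) (P : {poly R}) r : P.[r] != 0 ->
  exists l h, l < h /\ forall x, l < x < h -> (('X - r%:P) * P).[x] < 0.
Proof.
move=> P0; have [|e e_gt0 cont] := @poly_cont R r P `|P.[r]|; first by rewrite normr_gt0.
case: (ltP 0 P.[r]) => Pr.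
  exists (r - e), r; split=> [|x /andP[h1 h2]]; first by lra.
  have /cont : `|x - r| < e by rewrite ltr0_norm; lra.
  rewrite hornerM hornerXsubC (gtr0_norm Pr) => /ltr_normlP[h3 h4].
  by rewrite nmulr_rlt0; lra.
have {}Pr : P.[r] < 0 by rewrite lt_neqAle P0.
exists r, (r + e); split=> [|x /andP[h1 h2]]; first by lra.
have /cont : `|x - r| < e by rewrite gtr0_norm; lra.
rewrite hornerM hornerXsubC (ltr0_norm Pr) => /ltr_normlP[h3 h4].
by rewrite pmulr_rlt0; lra.
Qed.

(** Psi has the real root r = z + 1/z. A double root r of Psi would give the
    double root z of 'Phi_m, which is separable; so r is simple. *)
Lemma real_cyclotomic_negative m d (Psi : {poly int}) : (2 < m)%N -> (size Psi <= d.+1)%N ->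
    Psi`_d = 1 -> 'Phi_m = palindromic_of d Psi ->
  exists l h : realalg, l < h /\ forall x, l < x < h -> (map_poly intr Psi).[x] < 0.
Proof.
move=> m_gt2 sPsi Psid PhiE; pose C := complex realalg.
have m0 : m%:R != 0 :> C by rewrite pnatr_eq0; lia.
have [z prim_z] := closed_prim_root m0.
have z0 : z != 0 by rewrite (prim_root_eq0 prim_z); lia.
have [r rE] := complex_prim_root_real prim_z.
have PhiC : map_poly intr 'Phi_m = palindromic_of d (map_poly intr Psi) :> {poly C}.
  by rewrite PhiE map_palindromic_of.
pose P : {poly realalg} := map_poly intr Psi.
have PC : map_poly intr Psi = map_poly (real_complex _) P :> {poly C}.
  by rewrite -map_poly_comp; apply: eq_map_poly => i /=; rewrite rmorph_int.
have sP : size P = d.+1.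
  apply/eqP; rewrite eqn_leq (leq_trans (size_poly _ _)) //=.
  have : P`_d != 0 by rewrite coef_map Psid /= oner_eq0.
  by apply: contraR; rewrite -leqNgt => h; rewrite nth_default.
have sPC : (size (map_poly intr Psi : {poly C}) <= d.+1)%N by rewrite PC size_map_poly sP.
have Pr : root P r.
  have : root (map_poly intr 'Phi_m) z by rewrite root_Cyclotomic.
  rewrite rootE PhiC horner_palindromic_of // mulf_eq0 expf_eq0 (negPf z0) andbF /=.
  by rewrite rE PC horner_map /= fmorph_eq0.
have [Q PE] := factor_theorem _ _ Pr.
have [/factor_theorem[S QE]|nQ] := boolP (root Q r); last first.
  have [l [h [lh H]]] := simple_root_sign nQ; exists l, h; split=> // x /H.
  by rewrite mulrC -PE.
have P0 : P != 0 by rewrite -size_poly_eq0 sP.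
have S0 : S != 0 by apply: contraNneq P0 => S0; rewrite PE QE S0 !mul0r.
have sS : d = (size S).+1.
  move: sP; rewrite PE QE !size_Mmonic ?monicXsubC ?mulf_neq0 ?polyXsubC_eq0 // !size_XsubC.
  by rewrite !addn2 /= => -[->].
have [e dE] : exists e, d = e.+2 by exists (size S).-1; rewrite sS prednK // lt0n size_poly_eq0.
have SC : map_poly intr Psi =
    ('X - (r%:C%C)%:P) * (('X - (r%:C%C)%:P) * map_poly (real_complex _) S) :> {poly C}.
  by rewrite PC PE QE !rmorphM /= map_polyXsubC mulrC; congr (_ * _); rewrite mulrC.
have := separable_Cyclotomic m0; rewrite PhiC SC dE !palindromic_ofM_XsubC ?size_map_poly; last 2 first.
- by rewrite -ltnS -sS dE.
- by rewrite mulrC size_Mmonic ?monicXsubC ?map_poly_eq0 // size_XsubC size_map_poly addn2 /= -sS dE.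
have -> : 'X^2 + 1 - r%:C%C *: 'X = ('X - z%:P) * ('X - z^-1%:P) :> {poly C}.
  rewrite -rE -mul_polyC rmorphD /=.
  have : z%:P * z^-1%:P = 1 :> {poly C} by rewrite -rmorphM divff.
  by move: (z%:P) (z^-1%:P) => u v uv; rewrite -uv; ring.
rewrite -!mulrA separable_mul => /and3P[_ _].
rewrite coprimepMr coprimepMr => /and3P[_ + _].
by rewrite coprimep_XsubC root_XsubC eqxx.
Qed.

(** * Primes congruent to 3 modulo 4 dividing a value of Psi *)

(** The numerator is 1 modulo m and the denominator is a power of m, so the two
    are coprime and no prime outside m divides the denominator. *)
Lemma frac_in_interval (R : archiRealFieldType) (l h : R) m : (1 < m)%N -> l < h ->
  exists e (s : int), l < (1 + m%:Z * s)%:~R / (m%:R ^+ e.+1) < h.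
Proof.
move=> m_gt1 lt_lh; pose e := Num.Def.archi_bound (m%:R / (h - l)).
have m0 : 0 < m%:R :> R by rewrite ltr0n; lia.
have hl : 0 < h - l by lra.
pose t : R := m%:R ^+ e.+1.
have t0 : 0 < t by rewrite exprn_gt0.
have tP : m%:R < t * (h - l).
  rewrite -ltr_pdivrMr //; apply: lt_trans (archi_boundP _) _; first by rewrite divr_ge0 // ltW.
  by rewrite /t -natrX ltr_nat (leq_trans (ltn_expl _ m_gt1)) // leq_exp2l // ltnW.
(* s is chosen so that l t < 1 + m s <= l t + m, and l t + m < h t by tP *)
pose s := Num.floor ((l * t - 1) / m%:R) + 1.
exists e, s; rewrite -/t ltr_pdivlMr // ltr_pdivrMr // intrD intrM.
have [h1 h2] : (l * t - 1) / m%:R < s%:~R /\ s%:~R <= (l * t - 1) / m%:R + 1.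
  by rewrite /s floorD1_gt intrD lerD2r floor_le.
move: h1 h2; rewrite ltr_pdivrMr // -(ler_pM2r m0) mulrDl divfK ?gt_eqF //.
rewrite mul1r ![s%:~R * _]mulrC -pmulrn.
by move=> h1 h2; apply/andP; split; lra.
Qed.

Lemma prime_3mod4_divisor n : (n %% 4 = 3)%N ->
  exists p, [/\ prime p, (p %% 4 = 3)%N & (p %| n)%N].
Proof.
have [k] := ubnP n; elim: k n => // k IHk n; rewrite ltnS => le_nk n3.
have n_gt1 : (1 < n)%N by lia.
have pr_p := pdiv_prime n_gt1; have p_n := pdiv_dvd n.
have [p3|pn3] := eqVneq (pdiv n %% 4)%N 3; first by exists (pdiv n).
have [q nE] := dvdnP p_n.
have p_gt1 := prime_gt1 pr_p.
have q3 : (q %% 4 = 3)%N.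
  move: n3 pn3; rewrite {1}nE -modnMm.
  by have := ltn_pmod q (isT : 0 < 4)%N; have := ltn_pmod (pdiv n) (isT : 0 < 4)%N;
    case: (q %% 4)%N => [|[|[|[|?]]]] //; case: (_ %% 4)%N => [|[|[|[|?]]]].
have [|//|p [? ? pq]] := IHk q.
  by apply: leq_trans le_nk; rewrite nE ltn_Pmulr //; lia.
by exists p; split=> //; rewrite nE dvdn_mulr.
Qed.

(** The integer b^d P(a / b). *)
Definition homogeneous_eval d (P : {poly int}) (a b : int) : int :=
  \sum_(i < d.+1) P`_i * a ^+ i * b ^+ (d - i).

Lemma homogeneous_eval_horner (F : fieldType) d (P : {poly int}) (a b : int) :
  (size P <= d.+1)%N ->
  b%:~R != 0 :> F ->
  (homogeneous_eval d P a b)%:~R = b%:~R ^+ d * (map_poly intr P).[a%:~R / b%:~R] :> F.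
Proof.
move=> sP b0; rewrite (@horner_coef_wide _ d.+1) ?(leq_trans (size_poly _ _)) //.
rewrite mulr_sumr rmorph_sum; apply: eq_bigr => i _ /=; rewrite coef_map /= !rmorphM !rmorphXn /=.
have -> : b%:~R ^+ d = b%:~R ^+ (d - i) * b%:~R ^+ i :> F by rewrite -exprD subnK // -ltnS.
by rewrite exprMn exprVn; field; rewrite expf_neq0.
Qed.

Lemma homogeneous_eval_mod m d (P : {poly int}) (s b : int) : P`_d = 1 -> (m %| b)%Z ->
  (m %| homogeneous_eval d P (1 + m * s) b - 1)%Z.
Proof.
move=> Pd mb; rewrite /homogeneous_eval big_ord_recr /= Pd subnn expr0 mulr1 mul1r -addrA.
apply: rpredD; last first.
  by rewrite -[X in _ - X](expr1n _ d) subrXX dvdz_mulr // addrC addKr dvdz_mulr.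
apply: rpred_sum => i _; rewrite dvdz_mull //.
by have -> : (d - i = (d - i).-1.+1)%N; [have := ltn_ord i; lia | rewrite exprS dvdz_mulr].
Qed.

(** With a / b in an interval where Psi is negative, a = 1 modulo m and b a power
    of m, the integer n = - b^d Psi(a / b) is positive and congruent to -1
    modulo m, hence to 3 modulo 4. Some prime factor p of n is therefore 3
    modulo 4; it does not divide m, and a / b is a root of Psi modulo p. *)
Lemma exists_prime_root m : (2 < m)%N -> (4 %| m)%N ->
  exists p d (Psi : {poly int}) (x : 'F_p),
    [/\ prime p, (p %% 4 = 3)%N, ~~ (p %| m)%N &
      [/\ (size Psi <= d.+1)%N, 'Phi_m = palindromic_of d Psi &
          root (map_poly intr Psi) x]].
Proof.
move=> m_gt2 m4; have [d [Psi [sPsi Psid PhiE]]] := Cyclotomic_palindromic_of m_gt2.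
have [l [h [lt_lh neg]]] := real_cyclotomic_negative m_gt2 sPsi Psid PhiE.
have [|e [s itv]] := frac_in_interval (m := m) _ lt_lh; first by lia.
pose a : int := 1 + m%:Z * s; pose b : int := m%:Z ^+ e.+1.
have m0 : m%:R != 0 :> realalg by rewrite pnatr_eq0; lia.
have bE : b%:~R = m%:R ^+ e.+1 :> realalg by rewrite rmorphXn.
have b0 : 0 < b%:~R :> realalg by rewrite bE exprn_gt0 // ltr0n; lia.
have f_lt0 : homogeneous_eval d Psi a b < 0.
  rewrite -(@ltr_int realalg) homogeneous_eval_horner ?gt_eqF // pmulr_rlt0 ?exprn_gt0 //.
  by rewrite bE; apply: neg.
have fm : (m %| homogeneous_eval d Psi a b - 1)%Z.
  by apply: homogeneous_eval_mod; rewrite // /b exprS dvdz_mulr.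
have [n nE] : exists n : nat, homogeneous_eval d Psi a b = - n%:Z.
  by exists (absz (homogeneous_eval d Psi a b)); move: f_lt0; lia.
have n3 : (n %% 4 = 3)%N.
  have /dvdzP[c] : (4 %| homogeneous_eval d Psi a b - 1)%Z by apply: dvdz_trans fm.
  by rewrite nE; lia.
have [p [pr_p p3 pn]] := prime_3mod4_divisor n3.
have pf : (p %| homogeneous_eval d Psi a b)%Z by rewrite nE rpredN.
have npm : ~~ (p %| m)%N.
  apply/negP => pm; have : (p %| homogeneous_eval d Psi a b - (homogeneous_eval d Psi a b - 1)%R)%Z.
    by rewrite rpredB // (dvdz_trans _ fm).
  by rewrite subKr dvdzE /= dvdn1 => /eqP p1; rewrite p1 in pr_p.
exists p, d, Psi, (a%:~R / b%:~R); split=> //; split=> //.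
have chp := pchar_Fp pr_p.
have mp : m%:R != 0 :> 'F_p by rewrite -(dvdn_pcharf chp).
have bp : b%:~R != 0 :> 'F_p by rewrite rmorphXn /= expf_neq0.
have : (homogeneous_eval d Psi a b)%:~R = 0 :> 'F_p.
  by have /dvdzP[c ->] := pf; rewrite intrM -pmulrn (pcharf0 chp) mulr0.
rewrite homogeneous_eval_horner // => /eqP; rewrite mulf_eq0 expf_eq0 (negPf bp) andbF /=.
by [].
Qed.

(** * Square roots of small integers fixed by Frobenius *)

(** Evaluate (X^D - 1) / (X - 1), whose roots are the z^j with 0 < j < D, at 1 and
    pair the factors of z^j and z^(D-j). *)
Lemma odd_natr_prod (F : fieldType) h (z : F) : (h.*2.+1).-primitive_root z ->
  (h.*2.+1)%:R = \prod_(i < h) ((1 - z ^+ i.+1) * (1 - z ^- i.+1)).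
Proof.
move=> prim_z; have z0 : z != 0 by rewrite (prim_root_eq0 prim_z).
have prodE : \prod_(i < h.*2) ('X - (z ^+ i.+1)%:P) = \sum_(i < h.*2.+1) 'X^i.
  have := factor_Xn_sub_1 prim_z; rewrite big_nat_recl // expr0 subrX1.
  by rewrite big_mkord; apply: mulfI; rewrite polyXsubC_eq0.
have := congr1 (horner^~ 1) prodE; rewrite horner_prod horner_sum.
under [X in _ = X]eq_bigr do rewrite hornerXn expr1n.
rewrite sumr_const card_ord => <-; rewrite -addnn big_split_ord big_split /=.
congr (_ * _); first by apply: eq_bigr => i _; rewrite hornerXsubC.
rewrite (reindex_inj rev_ord_inj) /=; apply: eq_bigr => i _; rewrite hornerXsubC.
congr (_ - _); apply: (mulIf (expf_neq0 i.+1 z0)).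
rewrite mulVf ?expf_neq0 // -exprD -(prim_expr_order prim_z); congr (_ ^+ _).
by have := ltn_ord i; lia.
Qed.

Section FixedRoots.
Variables (F : fieldType) (phi : {rmorphism F -> F}).

(** By the product formula D = prod_j (1 - z^j) (1 - z^-j) with z = eta^2, and each
    factor is the square of I (eta^j - eta^-j), which phi fixes because it
    inverts both I and eta. *)
Lemma fixed_sqrt_odd h (I eta : F) : I ^+ 2 = -1 -> phi I = I^-1 ->
    (h.*2.+1).-primitive_root (eta ^+ 2) -> phi eta = eta^-1 ->
  exists2 s, phi s = s & (h.*2.+1)%:R = s ^+ 2.
Proof.
move=> I2 phiI prim phie.
have e0 : eta != 0.
  by have := prim_root_eq0 prim; rewrite expf_eq0 /= => ->.
have IV : I^-1 = - I.
  have I0 : I != 0 by apply: contra_eq_neq I2 => ->; rewrite expr0n eq_sym oppr_eq0 oner_eq0.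
  by apply: (mulfI I0); rewrite divff // mulrN -expr2 I2 opprK.
exists (\prod_(i < h) (I * (eta ^+ i.+1 - eta ^- i.+1))).
  rewrite rmorph_prod; apply: eq_bigr => i _.
  rewrite rmorphM rmorphB /= fmorphV !rmorphXn /= phiI phie IV.
  by rewrite exprVn invrK mulNr -mulrN opprB.
rewrite (odd_natr_prod prim) -prodrXl; apply: eq_bigr => i _.
rewrite [RHS]exprMn I2 exprAC.
by field; rewrite expf_neq0.
Qed.

(** w is a primitive eighth root of unity, and 2 = (w + 1/w)^2. *)
Lemma fixed_sqrt2 (w : F) : w ^+ 4 = -1 -> phi w = w^-1 ->
  exists2 s, phi s = s & 2%:R = s ^+ 2.
Proof.
move=> w4 phiw; have w0 : w != 0.
  by apply: contra_eq_neq w4 => ->; rewrite expr0n eq_sym oppr_eq0 oner_eq0.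
exists (w + w^-1); first by rewrite rmorphD /= fmorphV phiw invrK addrC.
have -> : (w + w^-1) ^+ 2 = 2%:R + (w ^+ 4 + 1) / w ^+ 2 by field.
by rewrite w4 addNr mul0r addr0.
Qed.

(** Powers of y provide every root of unity needed; an even D is reduced to D / 2
    by the square root of 2. *)
Lemma fixed_sqrt (M : nat) (y : F) : (8 * M`!).-primitive_root y -> phi y = y^-1 ->
  forall D, (0 < D <= M)%N -> exists2 s, phi s = s & D%:R = s ^+ 2.
Proof.
set m := (8 * M`!)%N => prim_y phiy.
have m_gt0 := prim_order_gt0 prim_y.
have phiX k : phi (y ^+ k) = (y ^+ k)^-1 by rewrite rmorphXn /= phiy exprVn.
have half k : (2 * k %| m)%N -> exists2 w : F, w ^+ k = -1 & phi w = w^-1.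
  move=> km; exists (y ^+ (m %/ (2 * k))); last exact: phiX.
  have prim := dvdn_prim_root prim_y km.
  set w := y ^+ _ in prim *.
  have /eqP : (w ^+ k) ^+ 2 = 1 by rewrite -exprM mulnC (prim_expr_order prim).
  rewrite sqrf_eq1 => /predU1P[/eqP|/eqP//].
  have := prim_order_gt0 prim.
  rewrite -(prim_order_dvd prim) => ? /dvdn_leq; lia.
have [I I2 phiI] := half 2 (dvdn_mulr _ (isT : 2 * 2 %| 8)%N).
have [w w4 phiw] := half 4 (dvdn_mulr _ (isT : 2 * 4 %| 8)%N).
move=> D; have [k] := ubnP D; elim: k D => // k IHk D; rewrite ltnS => le_Dk /andP[D0 DM].
have [oddD|evenD] := boolP (odd D).
  have DE : D = (D./2).*2.+1 by rewrite -[LHS]odd_double_half oddD.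
  have D2m : (2 * D %| m)%N by rewrite dvdn_mul // dvdn_fact // D0.
  rewrite DE; apply: (@fixed_sqrt_odd _ I (y ^+ (m %/ (2 * D)))) => //.
  have := dvdn_prim_root (dvdn_prim_root prim_y D2m) (dvdn_mull 2 (dvdnn D)).
  by rewrite mulnK // -DE.
have [||s phis Ds] := IHk D./2; [lia|lia|].
have [t phit t2] := fixed_sqrt2 w4 phiw.
exists (t * s); first by rewrite rmorphM /= phit phis.
by rewrite exprMn -t2 -Ds -natrM mul2n -[LHS](congr1 _ (odd_double_half D)) (negPf evenD).
Qed.

End FixedRoots.

Lemma Frobenius_fixed p (K : fieldType) (f : {rmorphism 'F_p -> K}) (s : K) :
  prime p -> s ^+ p = s -> exists t, f t = s.
Proof.
move=> pr_p sp; have : root (map_poly f ('X^p - 'X)) s.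
  by rewrite rmorphB /= map_polyXn map_polyX rootE !hornerE sp subrr.
have -> : 'X^p - 'X = \prod_(t : 'F_p) ('X - t%:P).
  by rewrite -finField_genPoly card_Fp.
rewrite rmorph_prod rootE horner_prod.
rewrite prodf_seq_eq0 => /hasP[t _] /=.
by rewrite map_polyXsubC hornerXsubC subr_eq0 => /eqP ->; exists t.
Qed.

(** Let p and x be as in exists_prime_root and write x = y + 1/y in an algebraic
    closure of 'F_p. Then y is a primitive m-th root of unity, and since x is
    fixed by Frobenius, y^p is y or 1/y. The first case would give p = 1 modulo m,
    against p = 3 modulo 4; so Frobenius inverts y and fixed_sqrt applies. *)
Lemma prime_small_squares M : exists p, [/\ prime p, (p %% 4 = 3)%N, (M < p)%N &
  forall D, (0 < D <= M)%N -> exists t : 'F_p, D%:R = t ^+ 2].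
Proof.
pose m := (8 * M`!)%N; have m_gt2 : (2 < m)%N by have := fact_gt0 M; lia.
have m4 : (4 %| m)%N by rewrite dvdn_mulr.
have [p [d [Psi [x [pr_p p3 npm [sPsi PhiE Psix]]]]]] := exists_prime_root m_gt2 m4.
exists p; split=> // [|D DM].
  by rewrite ltnNge; apply: contra npm => pM; rewrite dvdn_mull // dvdn_fact // prime_gt0.
have [K [f _]] := countable_algebraic_closure 'F_p.
have chK : p \in [pchar K] by rewrite (fmorph_pchar f) pchar_Fp.
have m0 : m%:R != 0 :> K by rewrite -(dvdn_pcharf chK).
have [y yE] : exists y, y ^+ 2 = f x * y - 1.
  have [y] := @solve_monicpoly K 2 (nth 0 [:: -1; f x]) isT.
  by rewrite !big_ord_recl big_ord0 /= => yE; exists y; rewrite yE; ring.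
have y0 : y != 0 by apply: contra_eq_neq yE => ->; rewrite expr0n mulr0 sub0r eq_sym oppr_eq0 oner_eq0.
have xE : f x = y + y^-1 by apply: (mulIf y0); rewrite mulrDl mulVf // -expr2 yE subrK.
have prim_y : m.-primitive_root y.
  rewrite -root_Cyclotomic // PhiE map_palindromic_of rootE horner_palindromic_of ?(leq_trans (size_poly _ _)) //.
  have -> : map_poly intr Psi = map_poly f (map_poly intr Psi) :> {poly K}.
    by rewrite -map_poly_comp; apply: eq_map_poly => i /=; rewrite rmorph_int.
  by rewrite -xE horner_map (rootP Psix) rmorph0 mulr0.
pose phi : {rmorphism K -> K} := pFrobenius_aut chK.
have phiE u : phi u = u ^+ p by exact: pFrobenius_autE.
have phix : phi (f x) = f x.
  by rewrite phiE -rmorphXn /=; have := expf_card x; rewrite card_Fp // => ->.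
have phiy : phi y = y^-1.
  have : (phi y - y) * (phi y - y^-1) = 0.
    have : phi (f x) = phi y + (phi y)^-1 by rewrite xE rmorphD /= fmorphV.
    rewrite phix xE => e; have py0 : phi y != 0 by rewrite fmorph_eq0.
    have -> : (phi y - y) * (phi y - y^-1) = phi y * (phi y + (phi y)^-1 - (y + y^-1)).
      by field; rewrite y0.
    by rewrite -e subrr mulr0.
  move/eqP; rewrite mulf_eq0 !subr_eq0 => /orP[|/eqP//].
  rewrite phiE -{2}[y]expr1 (eq_prim_root_expr prim_y) => e.
  have : (p == 1 %[mod 4])%N by rewrite -(modn_dvdm p m4) (eqP e) modn_dvdm.
  by rewrite p3.
have [s phis Ds] := @fixed_sqrt _ phi M y prim_y phiy D DM.
have [t tE] := Frobenius_fixed f pr_p (etrans (esym (phiE s)) phis).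
exists t; apply: (fmorph_inj f).
by rewrite rmorph_nat rmorphXn /= tE.
Qed.

(** * The Cauchy-Schwarz inequality for Gaussian integers *)

(** Lagrange's identity for the vectors v = a + i b and w = c + i d: twice the
    difference is the double sum of the squared norms of v_j w_l - v_l w_j. *)
Lemma cauchy_schwarz_int n (a b c d : 'I_n -> int) :
  (\sum_j (a j * c j + b j * d j)) ^+ 2 + (\sum_j (b j * c j - a j * d j)) ^+ 2 <=
  (\sum_j (a j ^+ 2 + b j ^+ 2)) * (\sum_j (c j ^+ 2 + d j ^+ 2)).
Proof.
rewrite -(ler_pM2l (isT : 0 < 2%:R :> int)) -subr_ge0.
set A := \sum_j (a j ^+ 2 + _); set B := \sum_j (c j ^+ 2 + _).
have -> : 2%:R * (A * B) = A * B + B * A by rewrite mulr_natl mulr2n [in X in _ + X]mulrC.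
rewrite mulrDr !expr2 /A /B !big_distrlr /= !mulr_sumr -!big_split -sumrB /=.
apply: sumr_ge0 => i _; rewrite !mulr_sumr -!big_split -sumrB /=.
apply: sumr_ge0 => j _.
have -> : forall u v w x : int, u + v - (w + x) = u + v - w - x by move=> *; ring.
have -> : (a i ^+ 2 + b i ^+ 2) * (c j ^+ 2 + d j ^+ 2) + (c i ^+ 2 + d i ^+ 2) * (a j ^+ 2 + b j ^+ 2)
  - 2 * ((a i * c i + b i * d i) * (a j * c j + b j * d j))
  - 2 * ((b i * c i - a i * d i) * (b j * c j - a j * d j)) =
  (a i * c j - b i * d j - a j * c i + b j * d i) ^+ 2 +
  (a i * d j + b i * c j - a j * d i - b j * c i) ^+ 2 by ring.
by rewrite addr_ge0 ?sqr_ge0.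
Qed.

Lemma sum_sqr_le n (a b : 'I_n -> int) :
  \sum_j (a j ^+ 2 + b j ^+ 2) <= (\sum_j (`|a j| + `|b j|)) ^+ 2.
Proof.
rewrite expr2 mulr_suml; apply: ler_sum => j _.
have le_j : `|a j| + `|b j| <= \sum_i (`|a i| + `|b i|).
  by rewrite (bigD1 j) //= lerDl sumr_ge0 // => i _; rewrite addr_ge0.
apply: le_trans (ler_wpM2l _ le_j); last by rewrite addr_ge0.
rewrite -[a j ^+ 2]real_normK ?num_real // -[b j ^+ 2]real_normK ?num_real //.
by have := normr_ge0 (a j); have := normr_ge0 (b j); nia.
Qed.

(** * Lifting short vectors to Gaussian integers *)

Section GaussianLift.
Variables (p : nat) (F : finFieldType).
Hypotheses (pr_p : prime p) (p3 : (p %% 4 = 3)%N) (cardF : #|F| = (p ^ 2)%N).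

Let chF : p \in [pchar F] := card_finPcharP cardF pr_p.

Lemma of_Fp_nat n : of_Fp F (n%:R : 'F_p) = n%:R.
Proof.
rewrite /of_Fp val_Fp_nat // {2}(divn_eq n p) natrD natrM (pcharf0 chF).
by rewrite mulr0 add0r.
Qed.

(** Write #|F| - 1 = 4h. The polynomial X^(2h) - 1 has at most 2h < 4h roots, so
    some non-zero x has x^(2h) = -1. *)
Lemma exists_imaginary : exists i : F, i ^+ 2 = -1.
Proof.
pose h := (#|F|.-1 %/ 4)%N.
have p_gt0 := prime_gt0 pr_p.
have pE : p = ((p %/ 4) * 4 + 3)%N by rewrite {1}(divn_eq p 4) p3.
have hE : #|F| = (h * 4).+1.
  have -> : #|F| = ((4 * (p %/ 4) ^ 2 + 6 * (p %/ 4) + 2) * 4).+1.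
    by rewrite cardF {1}pE; lia.
  by rewrite /h cardF -/(predn _) {1}pE; nia.
have h_gt0 : (0 < h)%N by have := prime_gt1 pr_p; move: hE; rewrite cardF; nia.
have [x x0 xh] : exists2 x : F, x != 0 & x ^+ (h * 2) != 1.
  have [/existsP[x /andP[]]|] := boolP [exists x : F, (x != 0) && (x ^+ (h * 2) != 1)].
    by exists x.
  rewrite negb_exists => /forallP all1; exfalso.
  have := @max_poly_roots F ('X^(h * 2) - 1) (enum (predC1 (0 : F))).
  rewrite -size_poly_eq0 size_XnsubC ?muln_gt0 ?h_gt0 // enum_uniq -cardE cardC1 hE.
  move=> H; have : (h * 4 < (h * 2).+1)%N; last by lia.
  apply: H => //; apply/allP => y; rewrite mem_enum inE => y0.
  by move: (all1 y); rewrite y0 negbK /= rootE !hornerE subr_eq0.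
exists (x ^+ h); have /eqP : (x ^+ (h * 2)) ^+ 2 = 1.
  apply: (mulfI x0); rewrite mulr1 -exprM -exprS -mulnA -hE.
  exact: expf_card.
by rewrite sqrf_eq1 (negPf xh) /= exprM => /eqP.
Qed.

Lemma two_neq0 : 2%:R != 0 :> F.
Proof.
rewrite -(dvdn_pcharf chF); apply/negP => /dvdn_leq.
by have : (p != 2)%N; [apply: contra_eq_neq p3 => -> | have := prime_gt1 pr_p; lia].
Qed.

Variable i : F.
Hypothesis i2 : i ^+ 2 = -1.

(** i^4 = 1 and p = 3 modulo 4, so i^p = i^3. *)
Lemma Frobenius_imaginary : i ^+ p = - i.
Proof.
have i4 : i ^+ 4 = 1 by rewrite (exprM i 2 2) i2 sqrrN expr1n.
by rewrite (divn_eq p 4) p3 exprD mulnC exprM i4 expr1n mul1r exprS i2 mulrN1.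
Qed.

Lemma natr_Fp_inj (x y : 'F_p) : (x : nat)%:R = (y : nat)%:R :> F -> x = y.
Proof.
wlog le_yx : x y / (y <= x)%N => [W e|/eqP].
  by case/orP: (leq_total y x) => /W; [apply | move=> ->].
rewrite -subr_eq0 -natrB // -(dvdn_pcharf chF) => dv.
have xp : (x < p)%N by have := ltn_ord x; rewrite {2}Fp_cast.
have xy : (x - y = 0)%N.
  by apply/eqP; apply: contraLR dv; rewrite -lt0n => h; rewrite gtnNdvd //; lia.
by apply: val_inj => /=; lia.
Qed.

(** The map (x, y) |-> x + y i from 'F_p * 'F_p to F is injective, as applying
    Frobenius to x + y i gives x - y i; both sides have p^2 elements. *)
Lemma decompose_imaginary (z : F) : exists x y : 'F_p, z = (x : nat)%:R + (y : nat)%:R * i.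
Proof.
pose g (u : 'F_p * 'F_p) : F := (u.1 : nat)%:R + (u.2 : nat)%:R * i.
have frob (x y : 'F_p) : g (x, y) ^+ p = (x : nat)%:R - (y : nat)%:R * i.
  have E u : u ^+ p = pFrobenius_aut chF u by rewrite pFrobenius_autE.
  rewrite E rmorphD rmorphM /= !pFrobenius_aut_nat -E Frobenius_imaginary.
  by rewrite mulrN.
have i0 : i != 0 by apply: contra_eq_neq i2 => ->; rewrite expr0n eq_sym oppr_eq0 oner_eq0.
have g_inj : injective g.
  move=> [x y] [x' y'] e.
  have e' := congr1 (fun u => u ^+ p) e; rewrite /= !frob in e'.
  rewrite /g /= in e.
  have ex : x = x'.
    apply: natr_Fp_inj; apply: (mulfI two_neq0).
    rewrite !mulr_natl !mulr2n.
    have -> : (x : nat)%:R + (x : nat)%:R =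
        (x : nat)%:R + (y : nat)%:R * i + ((x : nat)%:R - (y : nat)%:R * i) :> F by ring.
    by rewrite e e'; ring.
  congr (_, _) => //; apply: natr_Fp_inj; apply: (mulIf i0).
  by move: e; rewrite ex => /addrI.
have [|h _ hK] := inj_card_bij g_inj.
  by rewrite card_prod !card_Fp // cardF mulnn.
by exists (h z).1, (h z).2; rewrite -[LHS]hK /g.
Qed.

Variable conj : {rmorphism F -> F}.
Hypothesis conjP : nontrivial_automorphism conj.

(** conj i is a square root of -1; were it i, then conj would fix all of F. *)
Lemma conj_imaginary : conj i = - i.
Proof.
have /eqP : conj i ^+ 2 = i ^+ 2 by rewrite -rmorphXn /= i2 rmorphN1.
rewrite eqf_sqr => /predU1P[fix_i|/eqP //].
have [_ [z []]] := conjP; have [x [y ->]] := decompose_imaginary z.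
by rewrite rmorphD rmorphM /= !rmorph_nat fix_i.
Qed.

Definition lifts n (v : 'rV[F]_n) (a b : 'I_n -> int) :=
  forall j, v 0 j = (a j)%:~R + (b j)%:~R * i.

Definition l1 n (a b : 'I_n -> int) : int := \sum_j (`|a j| + `|b j|).

Lemma adj_step (u z : F) : adj u z ->
  exists s t : int, `|s| + `|t| = 1 /\ z = u + (s%:~R + t%:~R * i).
Proof.
case/andP=> _ /eqP.
set w := z - u => w4; have -> : z = u + w by rewrite addrC subrK.
have : (w - 1) * (w + 1) * ((w - i) * (w + i)) = 0.
  have -> : (w - 1) * (w + 1) * ((w - i) * (w + i)) =
            w ^+ 4 - w ^+ 2 * (i ^+ 2 + 1) + i ^+ 2 by ring.
  by rewrite w4 i2; ring.
move/eqP; rewrite !mulf_eq0 !subr_eq0 !addr_eq0 -!orbA => /or4P[] /eqP ->.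
- by exists 1, 0; split=> //; rewrite mul0r addr0.
- by exists (-1), 0; split=> //; rewrite mul0r addr0 rmorphN1.
- by exists 0, 1; split=> //; rewrite mul1r add0r.
- by exists 0, (-1); split=> //; rewrite rmorphN1 mulN1r add0r.
Qed.

Lemma cartesian_adj_lift n (v w : 'rV[F]_n) a b : cartesian_adj v w -> lifts v a b ->
  exists a' b', lifts w a' b' /\ l1 a' b' <= l1 a b + 1.
Proof.
case/existsP=> j /andP[/adj_step[s [t [st wj]]] /forallP same] vab.
exists (fun l => a l + s *+ (l == j)), (fun l => b l + t *+ (l == j)); split=> [l|].
  have [->|ne_lj] := eqVneq l j; first by rewrite wj vab !mulr1n !rmorphD /=; ring.
  by have := same l; rewrite ne_lj /= => /eqP <-; rewrite vab !mulr0n !addr0.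
rewrite /l1 (bigD1 j) //= [in leRHS](bigD1 j) //= eqxx !mulr1n.
rewrite [in leLHS](eq_bigr (fun l => `|a l| + `|b l|)) => [|l /negPf ->]; last first.
  by rewrite !mulr0n !addr0.
rewrite [leRHS]addrAC lerD2r -st addrACA lerD //; exact: ler_normD.
Qed.

Lemma path_lift n (v : 'rV[F]_n) t a b : path (@cartesian_adj F n) v t -> lifts v a b ->
  exists a' b', lifts (last v t) a' b' /\ l1 a' b' <= l1 a b + (size t)%:Z.
Proof.
elim: t v a b => [|w t IHt] v a b /=; first by move=> _ ?; exists a, b; rewrite addr0.
case/andP=> vw /IHt{}IHt /(cartesian_adj_lift vw)[a' [b' [wab le1]]].
have [a2 [b2 [? le2]]] := IHt _ _ wab; exists a2, b2; split=> //.
by apply: le_trans le2 _; rewrite intS; lia.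
Qed.

(** Every edge of a walk adds a fourth root of unity to one coordinate, which
    raises the l1-norm of a lift by at most 1. The bound k < p excludes the
    value that graph_dist takes at unreachable vertices, the number of
    vertices p^(2n). *)
Lemma manhattan_lift n (v : 'rV[F]_n) k : (0 < n)%N -> (k < p)%N ->
    (manhattan_norm v <= k)%N ->
  exists a b, lifts v a b /\ l1 a b <= k%:Z.
Proof.
move=> n_gt0 kp; rewrite /manhattan_norm /graph_dist; set s := iota _ _ => le_k.
have lt_f : (find (walk_of_length (@cartesian_adj F n) 0%R v) s < size s)%N.
  apply: leq_ltn_trans le_k _; rewrite size_iota card_mx mul1n cardF -expnM.
  by rewrite (leq_trans kp) // -{1}[p]expn1 leq_exp2l ?prime_gt1 //; lia.
have hs := lt_f; rewrite -has_find in hs.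
have := nth_find 0%N hs; rewrite nth_iota ?add0n; last by move: lt_f; rewrite size_iota.
case/existsP=> t /andP[pt /eqP lt].
have l0 : lifts (0 : 'rV[F]_n) (fun=> 0) (fun=> 0) by move=> j; rewrite mxE mul0r addr0.
have [a [b [vab le1]]] := path_lift pt l0; exists a, b; rewrite -{1}lt; split=> //.
apply: le_trans le1 _; rewrite /l1 big1 ?add0r => [|j _]; last exact: normr0.
by rewrite size_tuple lez_nat.
Qed.

Lemma inner_lift n (v w : 'rV[F]_n) a b c d : lifts v a b -> lifts w c d ->
  inner conj v w =
    (\sum_j (a j * c j + b j * d j))%:~R + (\sum_j (b j * c j - a j * d j))%:~R * i.
Proof.
move=> vab wcd; rewrite !rmorph_sum mulr_suml -big_split; apply: eq_bigr => j _ /=.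
rewrite vab wcd rmorphD rmorphM /= !rmorph_int conj_imaginary !rmorphD rmorphN !rmorphM /=.
have E (A B C D : F) : (A + B * i) * (C + D * - i) =
    A * C - B * D * i ^+ 2 + (B * C - A * D) * i by ring.
by rewrite E i2 mulrN1 opprK.
Qed.

(** With X + i Y the inner product of the lifts and A, B their squared norms, the
    two sides are the residues of X^2 + Y^2 and A B, and the integer
    A B - X^2 - Y^2 lies between 0 and k^4. *)
Lemma inner_le k n (v w : 'rV[F]_n) a b c d :
    (forall D, (0 < D <= k ^ 4)%N -> exists t : 'F_p, D%:R = t ^+ 2) ->
    lifts v a b -> l1 a b <= k%:Z -> lifts w c d -> l1 c d <= k%:Z ->
  le_prime_subfield p (inner conj v w * inner conj w v) (inner conj v v * inner conj w w).
Proof.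
move=> sqs vab abk wcd cdk.
rewrite (inner_lift vab wcd) (inner_lift wcd vab) (inner_lift vab vab) (inner_lift wcd wcd).
set X := \sum_j (a j * c j + b j * d j); set Y := \sum_j (b j * c j - a j * d j).
have -> : \sum_j (c j * a j + d j * b j) = X by apply: eq_bigr => j _; rewrite mulrC [b j * _]mulrC.
have -> : \sum_j (d j * a j - c j * b j) = - Y.
  by rewrite -sumrN; apply: eq_bigr => j _; ring.
rewrite ![\sum_j (_ * _ - _ * _)]big1 ?mul0r ?addr0 => [|j _|j _]; try by rewrite mulrC subrr.
have CS := cauchy_schwarz_int a b c d; rewrite -/X -/Y in CS.
have sqsum (a' b' : 'I_n -> int) : l1 a' b' <= k%:Z ->
    exists2 N : nat, \sum_j (a' j * a' j + b' j * b' j) = N%:Z & (N <= k ^ 2)%N.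
  move=> le1; have le2 := sum_sqr_le a' b'.
  have l1_ge0 : 0 <= l1 a' b' by apply: sumr_ge0 => j _; rewrite addr_ge0.
  have ge0 : 0 <= \sum_j (a' j * a' j + b' j * b' j).
    by apply: sumr_ge0 => j _; rewrite addr_ge0 // -expr2 sqr_ge0.
  exists (absz (\sum_j (a' j * a' j + b' j * b' j))); first by rewrite gez0_abs.
  rewrite -lez_nat gez0_abs // (le_trans le2) // -/(l1 _ _).
  by rewrite -mulnn PoszM -expr2 lerXn2r.
have [A AE Ak] := sqsum _ _ abk; have [B BE Bk] := sqsum _ _ cdk.
rewrite AE BE in CS *.
have [N NE] : exists N : nat, X ^+ 2 + Y ^+ 2 = N%:Z.
  by exists (absz (X ^+ 2 + Y ^+ 2)); rewrite gez0_abs // addr_ge0 ?sqr_ge0.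
have NAB : (N <= A * B)%N by move: CS; rewrite NE -lez_nat PoszM.
exists N%:R, (A * B)%:R; rewrite !of_Fp_nat natrM; split=> //.
  have E (x y : F) : (x + y * i) * (x - y * i) = x ^+ 2 - y ^+ 2 * i ^+ 2 by ring.
  by rewrite rmorphN mulNr E i2 mulrN1 opprK -!rmorphXn -rmorphD NE.
have [->|ne] := eqVneq (N%:R : 'F_p) (A * B)%:R; first by right.
have ltN : (N < A * B)%N by rewrite ltn_neqAle NAB andbT; apply: contraNneq ne => ->.
have [|t tE] := sqs (A * B - N)%N.
  rewrite subn_gt0 ltN (leq_trans (leq_subr _ _)) //.
  by rewrite -[4%N]/(2 + 2)%N expnD leq_mul.
by left; exists t; rewrite -tE natrB //; split=> //; apply/eqP; rewrite subr_eq0 eq_sym.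
Qed.

End GaussianLift.

Theorem mainTheorem4 (k : nat) (hk : (1 <= k)%N) :
  exists p : nat,
    [/\ prime p, (p = 3 %[mod 4])%N &
      forall (F : finFieldType) (hF : #|F| = (p ^ 2)%N)
        (conj : {rmorphism F -> F}) (hconj : nontrivial_automorphism conj)
        (n : nat) (hn : (1 <= n)%N) (v w : 'rV[F]_n),
        (manhattan_norm v <= k)%N -> (manhattan_norm w <= k)%N ->
        le_prime_subfield p (inner conj v w * inner conj w v)
                            (inner conj v v * inner conj w w)].
Proof.
have [p [pr_p p3 Mp sqs]] := prime_small_squares (k ^ 4).
exists p; split=> // F cardF conj conjP n n_gt0 v w vk wk.
have [i i2] := exists_imaginary pr_p p3 cardF.
have kp : (k < p)%N by apply: leq_ltn_trans Mp; rewrite -{1}[k]expn1 leq_pexp2l.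
have [a [b [vab abk]]] := manhattan_lift pr_p p3 cardF i2 n_gt0 kp vk.
have [c [d [wcd cdk]]] := manhattan_lift pr_p p3 cardF i2 n_gt0 kp wk.
exact: (inner_le pr_p p3 cardF i2 conjP sqs vab abk wcd cdk).
Qed.
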